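(* For $p\in(0,1)$, \[ f(K_3,p)=\Theta(p^{-3/2}),\qquad f(K_4,p)=\Theta(p^{-2}),\qquad f(K_5,p)=\Theta(p^{-8/3}), \] with absolute implicit constants.
   Context: In the Subgraph Query Game with parameter $p\in(0,1)$, Builder plays alone on the random graph $G(\mathbb Z,p)$ with infinitely many vertices, whose edges are initially hidden. At each turn Builder queries (adaptively) one pair of vertices and is told whether it is an edge; equivalently, each queried edge is built successfully, independently, with probability $p$, and each pair may be queried at most once. For a graph $H$, $f(H,p)$ is the minimum, over all Builder strategies, of the number of turns needed to build a copy of $H$ with probability at least $\frac12$. *)

(* Defs.v *)
From HB Require Import structures.
From mathcomp Require Import all_boot all_order all_algebra.
From mathcomp Require Import all_classical all_reals all_analysis.
Set Implicit Arguments.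
Unset Strict Implicit.
Unset Printing Implicit Defensive.
Import Order.TTheory GRing.Theory Num.Theory.
Local Open Scope ring_scope.

Record sgraph := SGraph {
  vertex :> finType;
  adj : rel vertex;
  adj_sym : symmetric adj;
  adj_irr : irreflexive adj }.

Definition complete_rel (n : nat) : rel 'I_n := fun x y => x != y.
Arguments complete_rel : clear implicits.

Fact complete_sym n : symmetric (complete_rel n).
Proof. by move=> x y; rewrite /complete_rel eq_sym. Qed.

Fact complete_irr n : irreflexive (complete_rel n).
Proof. by move=> x; rewrite /complete_rel eqxx. Qed.

Definition K (n : nat) : sgraph := SGraph (@complete_sym n) (@complete_irr n).

(* An unordered pair of distinct vertices of the board, whose vertex set is the
   set of integers, is represented by its increasing enumeration. *)
Definition epair : Type := {x : int * int | x.1 < x.2}.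

(* The queries made so far with their answers, in chronological order. *)
Definition history : Type := seq (epair * bool).

(* Stopping is not an option: a query that Builder does not need can only help.
   Requiring a fresh query also after histories that the strategy itself never
   produces is harmless, since a fresh pair always exists. *)
Record strategy := Strategy {
  query :> history -> epair;
  query_fresh : forall h : history, query h \notin unzip1 h }.

Definition play (s : strategy) (w : seq bool) : history :=
  foldl (fun h b => rcons h (s h, b)) [::] w.

Definition built (h : history) (u v : int) : bool :=
  has (fun q : epair * bool =>
         q.2 && ((\val q.1 == (u, v)) || (\val q.1 == (v, u)))) h.

(* A copy is a not necessarily induced subgraph. *)
Definition has_copy (H : sgraph) (h : history) : Prop :=
  exists phi : H -> int,
    injective phi /\ forall x y : H, adj x y -> built h (phi x) (phi y).

(* As no pair is queried twice, the answers to the first N queries are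
   independent Bernoulli(p) bits, whatever the strategy. *)
Definition win_prob (R : realType) (H : sgraph) (p : R) (s : strategy)
    (N : nat) : R :=
  \sum_(w : N.-tuple bool | `[< has_copy H (play s w) >])
    \prod_(b <- w) bernoulli_pmf p b.

(* The infimum is a minimum as soon as some strategy succeeds; it is +oo
   otherwise. *)
Definition f (R : realType) (H : sgraph) (p : R) : \bar R :=
  ereal_inf [set (N%:R : R)%:E | N in
    [set N : nat | exists s : strategy, 2^-1 <= win_prob H p s N]]%classic.

(* F = Theta(g) on the whole interval ]0, 1[, with constants independent of
   the parameter. *)
Definition theta01 (R : realType) (F : R -> \bar R) (g : R -> R) : Prop :=
  exists c C : R, 0 < c /\ 0 < C /\
    forall p : R, 0 < p < 1 -> ((c * g p)%:E <= F p <= (C * g p)%:E)%E.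

(* Main.v *)
Require Import Defs.
From mathcomp Require Import all_boot all_order all_algebra.
From mathcomp Require Import all_classical all_reals all_analysis.
From mathcomp Require Import ring lra zify.
Set Implicit Arguments.
Unset Strict Implicit.
Unset Printing Implicit Defensive.
Import Order.TTheory GRing.Theory Num.Theory.
Local Open Scope ring_scope.

(* Lower bounds. Order the edges of a copy of the target by the time at which
   they were built, and choose among them [F] free edges. A free edge may be any
   of the successful queries, about [p N] in number; an edge both of whose end
   points lie on earlier free edges is forced: its pair is determined, and is
   queried at most once, so it costs a factor [p]. With [J] forced edges, the
   expected number of copies is [O((p N)^F p^J)]. Every ordering of the edges
   admits [(F, J)] equal to [(2, 1)] for the triangle, [(2, 2)] for [K 4] and
   [(3, 5)] for [K 5], which is a finite verification; hence [N] is at least of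
   the order of [p^-((F + J) / F)].

   Upper bounds. Take [k] disjoint parts whose sizes are a large constant times
   [p^-(3/2)] for the triangle, [p^-2] for [K 4] and [p^-(8/3)] for [K 5],
   except that the first part has constant size and, for [K 5], the second has
   size of order [p^-2]. A second moment computation shows that with high
   probability the random graph has a clique meeting every part. Builder only
   queries a pair between parts [i < j] when its end points are joined to a
   common clique meeting the parts before [i]; the expected number of such
   pairs is [O(p^-b)], where [b] is the exponent to be proved. *)

(** * Expectation over a run of a strategy *)

Definition step (R : realType) (p : R) (s : strategy) (F : history -> R)
    (h : history) : R :=
  p * F (rcons h (s h, true)) + (1 - p) * F (rcons h (s h, false)).

(** Backward recursion on the game tree: the value at [h] is the mean of [F] after [n] further
    queries, with no explicit probability space. *)
Definition expect (R : realType) (p : R) (s : strategy) (n : nat)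
    (F : history -> R) : history -> R :=
  iter n (step p s) F.

Definition wins (R : realType) (H : sgraph) (h : history) : R :=
  (`[< has_copy H h >])%:R.

Lemma sum_tuple_expect (R : realType) (p : R) (s : strategy) (n : nat)
    (F : history -> R) (h : history) :
  \sum_(w : n.-tuple bool) (\prod_(b <- w) bernoulli_pmf p b) *
    F (foldl (fun h b => rcons h (s h, b)) h w) = expect p s n F h.
Proof.
elim: n h => [|n IHn] h.
  by rewrite (big_pred1 [tuple]) /= ?big_nil ?mul1r // => w; apply/esym/eqP; exact: tuple0.
rewrite (reindex (fun x : bool * n.-tuple bool => [tuple of x.1 :: x.2])) /=; last first.
  exists (fun w => (thead w, [tuple of behead w])) => [[b w]|w] _ /=.
    by rewrite theadE; congr pair; apply: val_inj.
  by rewrite -tuple_eta.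
rewrite -(pair_bigA _ (fun b (w : n.-tuple bool) =>
  (\prod_(c <- b :: w) bernoulli_pmf p c) *
  F (foldl (fun h b => rcons h (s h, b)) (rcons h (s h, b)) w))) /=.
have splitE (b : bool) : \sum_(w : n.-tuple bool) (\prod_(c <- b :: w) bernoulli_pmf p c) *
    F (foldl (fun h b => rcons h (s h, b)) (rcons h (s h, b)) w) =
    bernoulli_pmf p b * expect p s n F (rcons h (s h, b)).
  rewrite -IHn mulr_sumr; apply: eq_bigr => w _.
  by rewrite big_cons mulrA.
by rewrite big_bool !splitE.
Qed.

Lemma win_probE (R : realType) (H : sgraph) (p : R) (s : strategy) (N : nat) :
  win_prob H p s N = expect p s N (wins R H) [::].
Proof.
rewrite -sum_tuple_expect /win_prob big_mkcond; apply: eq_bigr => w _.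
by rewrite /wins /play; case: asboolP; rewrite ?mulr1 ?mulr0.
Qed.

(** Isolates the last query instead of the first, as the counts below are updated by the last
    query. *)
Lemma expectS (R : realType) (p : R) (s : strategy) (n : nat)
    (F : history -> R) (h : history) :
  expect p s n.+1 F h = expect p s n (step p s F) h.
Proof. by rewrite /expect iterSr. Qed.

Lemma expectD (R : realType) (p : R) (s : strategy) (n : nat)
    (F G : history -> R) (h : history) :
  expect p s n (fun h => F h + G h) h = expect p s n F h + expect p s n G h.
Proof.
elim: n h => [//|n IHn] h; rewrite /= /step !IHn; ring.
Qed.

Lemma expectZ (R : realType) (p : R) (s : strategy) (n : nat) (c : R)
    (F : history -> R) (h : history) :
  expect p s n (fun h => c * F h) h = c * expect p s n F h.
Proof.
elim: n h => [//|n IHn] h; rewrite /= /step !IHn; ring.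
Qed.

Lemma expect_sum (R : realType) (p : R) (s : strategy) (n : nat) (I : Type)
    (r : seq I) (F : I -> history -> R) (h : history) :
  expect p s n (fun h => \sum_(i <- r) F i h) h =
  \sum_(i <- r) expect p s n (F i) h.
Proof.
elim: n h => [//|n IHn] h; rewrite /= /step !IHn !mulr_sumr -big_split.
by [].
Qed.

(** Freshness keeps the queried pairs distinct, so [F <= G] is only required on histories without
    repetition. *)
Lemma expect_le (R : realType) (p : R) (s : strategy) (n : nat)
    (F G : history -> R) (h : history) :
  0 <= p <= 1 -> uniq (unzip1 h) ->
  (forall h, uniq (unzip1 h) -> F h <= G h) ->
  expect p s n F h <= expect p s n G h.
Proof.
move=> /andP[p0 p1] + leFG; elim: n h => [|n IHn] h uh; first exact: leFG.
have ub b : uniq (unzip1 (rcons h (s h, b))).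
  by rewrite /unzip1 map_rcons rcons_uniq uh query_fresh.
by rewrite /= /step lerD // ler_wpM2l ?subr_ge0 ?IHn.
Qed.

Lemma expect_const (R : realType) (p : R) (s : strategy) (n : nat) (c : R)
    (h : history) : expect p s n (fun=> c) h = c.
Proof. elim: n h => [//|n IHn] h; rewrite /= /step !IHn; ring. Qed.

(** * Lower bounds *)

(* An edge of the target is marked [Some true] if it is free, [Some false] if
   it is forced, and [None] if it is disregarded; the latest edge comes first. *)
Definition pattern : Type := seq (option bool * (nat * nat)).

Definition frees (P : pattern) : nat := count (fun x => x.1 == Some true) P.

Definition forceds (P : pattern) : nat := count (fun x => x.1 == Some false) P.

Definition joins (psi : nat -> int) (ab : nat * nat) (e : epair) : bool :=
  (\val e == (psi ab.1, psi ab.2)) || (\val e == (psi ab.2, psi ab.1)).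

(** A vertex that already has an image is overwritten without any consistency check. Spurious
    embeddings may be counted; what matters is that a true copy is among them. *)
Definition put (ab : nat * nat) (u v : int) (psi : nat -> int) : nat -> int :=
  fun x => if x == ab.1 then u else if x == ab.2 then v else psi x.

(* The partial embeddings of [P] along a history whose latest query comes
   first. *)
Fixpoint embs (P : pattern) : history -> seq (nat -> int) :=
  match P with
  | [::] => fun=> [:: fun=> 0]
  | (None, _) :: P' => embs P'
  | (Some k, ab) :: P' =>
    fix go (H : history) :=
      if H is (e, ans) :: H' then
        (if ans then
           if k then [seq put ab (\val e).1 (\val e).2 psi | psi <- embs P' H'] ++
                     [seq put ab (\val e).2 (\val e).1 psi | psi <- embs P' H']
           else [seq psi <- embs P' H' | joins psi ab e]
         else [::]) ++ go H'
      else [::]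
  end.

Lemma embs_cons (P : pattern) (q : epair * bool) (H : history) :
  exists l, embs P (q :: H) = l ++ embs P H.
Proof.
elim: P => [|[[k|] ab] P IHP] /=; first by exists [::].
- by case: q IHP => e ans _; eexists.
- exact: IHP.
Qed.

Definition nembs (R : realType) (P : pattern) (h : history) : R :=
  (size (embs P (rev h)))%:R.

(** A successful query extends every embedding of [P] in both orientations, hence the factor 2. *)
Lemma step_free (R : realType) (p : R) (s : strategy) (ab : nat * nat)
    (P : pattern) (h : history) :
  step p s (nembs R ((Some true, ab) :: P)) h =
  nembs R ((Some true, ab) :: P) h + 2 * p * nembs R P h.
Proof.
rewrite /step /nembs !rev_rcons /= !size_cat !size_map /= !natrD; ring.
Qed.

(** The increments of [step_free] are summed over the [N] queries, each being bounded by the last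
    one since [c] is monotone. *)
Lemma expect_free (R : realType) (p : R) (s : strategy) (ab : nat * nat)
    (P : pattern) (c : nat -> R) :
  0 <= p <= 1 -> {homo c : m n / (m <= n)%N >-> m <= n} ->
  (forall N, expect p s N (nembs R P) [::] <= c N) ->
  forall N, expect p s N (nembs R ((Some true, ab) :: P)) [::] <=
            2 * p * N%:R * c N.
Proof.
move=> /andP[p0 p1] cmono leP; elim=> [|N IHN].
  by rewrite /= /nembs /= mulr0 mul0r.
rewrite expectS (_ : step _ _ _ = fun h => nembs R ((Some true, ab) :: P) h +
    2 * p * nembs R P h); last by apply: funext => h; rewrite step_free.
rewrite expectD expectZ.
have le_c : c N <= c N.+1 by apply: cmono.
have leX : 2 * p * expect p s N (nembs R P) [::] <= 2 * p * c N.+1.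
  by rewrite ler_wpM2l ?mulr_ge0 //; apply: le_trans (leP N) le_c.
have leY : 2 * p * N%:R * c N <= 2 * p * N%:R * c N.+1.
  by rewrite ler_wpM2l // !mulr_ge0.
rewrite -natr1; lra.
Qed.

Lemma joins_inj (psi : nat -> int) (ab : nat * nat) (e e' : epair) :
  joins psi ab e -> joins psi ab e' -> e = e'.
Proof.
case: e e' => [[u v] /= luv] [[u' v'] /= luv'].
rewrite /joins /= !xpair_eqE => H H'; apply: val_inj => /=.
by congr pair; move: luv luv' H H' => /=; lia.
Qed.

(* [nembs P] restricted to the embeddings under which [ab] has been queried:
   each of these was closed by a single query, which succeeded with
   probability [p]. *)
Definition nqueried (R : realType) (P : pattern) (ab : nat * nat)
    (h : history) : R :=
  (count (fun psi => has (joins psi ab) (unzip1 (rev h))) (embs P (rev h)))%:R.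

Lemma step_forced (R : realType) (p : R) (s : strategy) (ab : nat * nat)
    (P : pattern) (h : history) :
  step p s (nembs R ((Some false, ab) :: P)) h =
  nembs R ((Some false, ab) :: P) h +
  p * (count (fun psi => joins psi ab (s h)) (embs P (rev h)))%:R.
Proof.
rewrite /step /nembs !rev_rcons /= !size_cat size_filter /= !natrD; ring.
Qed.

(** Freshness of [s h] makes the embeddings whose pair is queried now disjoint from those whose pair
    was queried before. *)
Lemma nqueried_step (R : realType) (s : strategy) (ab : nat * nat)
    (P : pattern) (h : history) (b : bool) :
  nqueried R P ab h +
    (count (fun psi => joins psi ab (s h)) (embs P (rev h)))%:R <=
  nqueried R P ab (rcons h (s h, b)).
Proof.
rewrite /nqueried rev_rcons -natrD ler_nat.
have [l ->] := embs_cons P (s h, b) (rev h).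
rewrite count_cat; apply: leq_trans (leq_addl _ _).
set A := fun psi => has (joins psi ab) (unzip1 (rev h)).
set B := fun psi => joins psi ab (s h).
rewrite addnC -count_predUI.
have -> : count (predI B A) (embs P (rev h)) = 0%N.
  apply/eqP; rewrite -leqn0 leqNgt -has_count; apply/negP => /hasP[psi _ /=].
  rewrite /A /B => /andP[Bpsi /hasP[e ein Je]].
  have := query_fresh s h; rewrite (joins_inj Bpsi Je).
  by rewrite -mem_rev -map_rev ein.
by rewrite addn0; apply: sub_count => psi /=; rewrite /A /B.
Qed.

(** The forced count grows on average by [p] times the number of embeddings whose pair is being
    queried. Each embedding has its pair queried at most once, so these numbers add up to at most
    [nqueried]. *)
Lemma expect_forced (R : realType) (p : R) (s : strategy) (ab : nat * nat)
    (P : pattern) (N : nat) :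
  0 <= p <= 1 ->
  expect p s N (nembs R ((Some false, ab) :: P)) [::] <=
  p * expect p s N (nembs R P) [::].
Proof.
move=> p01; have /andP[p0 p1] := p01.
apply: (@le_trans _ _ (p * expect p s N (nqueried R P ab) [::])); last first.
  rewrite ler_wpM2l //; apply: expect_le => // h _.
  by rewrite /nqueried /nembs ler_nat count_size.
elim: N => [|N IHN]; first by rewrite /= /nembs /nqueried /= mulr_ge0.
rewrite !expectS (_ : step _ _ _ = fun h => nembs R ((Some false, ab) :: P) h +
    p * (count (fun psi => joins psi ab (s h)) (embs P (rev h)))%:R); last first.
  by apply: funext => h; rewrite step_forced.
rewrite expectD expectZ.
set G := fun h => (count _ _)%:R.
(* The bound of [nqueried_step] holds for either answer, hence for their mean. *)
have : expect p s N (fun h => nqueried R P ab h + G h) [::] <=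
    expect p s N (step p s (nqueried R P ab)) [::].
  apply: expect_le => // h _.
  have := nqueried_step R s ab P h true; have := nqueried_step R s ab P h false.
  rewrite -/(G h) /step.
  set x := nqueried _ _ _ h; set y := nqueried _ _ _ _; set z := nqueried _ _ _ _.
  by move=> ly lz; nra.
rewrite expectD => le1.
have : p * (expect p s N (nqueried R P ab) [::] + expect p s N G [::]) <=
   p * expect p s N (step p s (nqueried R P ab)) [::] by rewrite ler_wpM2l.
by move: IHN; lra.
Qed.

Lemma expect_nembs (R : realType) (p : R) (s : strategy) (P : pattern) (N : nat) :
  0 <= p <= 1 ->
  expect p s N (nembs R P) [::] <=
  (2 * p * N%:R) ^+ frees P * p ^+ forceds P.
Proof.
move=> p01; have /andP[p0 p1] := p01; elim: P N => [|[[[]|] ab] P IHP] N /=.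
- by rewrite expect_const mulr1.
- rewrite add0n exprS -mulrA.
  apply: (expect_free _ (c := fun N => (2 * p * N%:R) ^+ frees P * p ^+ forceds P)) => //.
  move=> m n lemn; rewrite ler_wpM2r ?exprn_ge0 // lerXn2r ?nnegrE ?mulr_ge0 //.
  by rewrite ler_wpM2l ?mulr_ge0 // ler_nat.
- rewrite add0n exprS mulrCA; apply: le_trans (expect_forced _ _ _ _ p01) _.
  by rewrite ler_wpM2l.
- exact: IHP.
Qed.

(** * The building order of a copy and its marked pattern *)

Definition verts (L : seq (nat * nat)) : seq nat :=
  flatten [seq [:: x.1; x.2] | x <- L].

(* The latest edge comes first in [L]. *)
Definition closes (fs L : seq (nat * nat)) (x : nat * nat) : bool :=
  let V := verts [seq y <- L | y \in fs] in
  [&& x \notin fs, x.1 \in V & x.2 \in V].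

Fixpoint mark (fs L : seq (nat * nat)) : pattern :=
  if L is x :: L' then
    (if x \in fs then Some true
     else if closes fs L' x then Some false else None, x) :: mark fs L'
  else [::].

Definition pairs (k : nat) : seq (nat * nat) :=
  [seq ab <- [seq (a, b) | a <- iota 0 k, b <- iota 0 k] | (ab.1 < ab.2)%N].

Definition role (k : nat) (phi : nat -> int) (q : epair * bool) : option (nat * nat) :=
  if q.2 then ohead [seq ab <- pairs k | joins phi ab q.1] else None.

(** The building order of the copy [phi], latest edge first when [H] lists the latest query
    first. *)
Definition trace (k : nat) (phi : nat -> int) (H : history) : seq (nat * nat) :=
  pmap (role k phi) H.

Lemma role_joins (k : nat) (phi : nat -> int) (q : epair * bool) (x : nat * nat) :
  role k phi q = Some x -> [/\ q.2, joins phi x q.1 & x \in pairs k].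
Proof.
rewrite /role; case: q.2 => //.
case E: [seq _ <- _ | _] => [//|y l] [<-].
have : y \in [seq ab <- pairs k | joins phi ab q.1] by rewrite E mem_head.
by rewrite mem_filter => /andP[].
Qed.

Lemma put_agree (phi psi : nat -> int) (ab : nat * nat) (V : seq nat) :
  all (fun v => psi v == phi v) V ->
  all (fun v => put ab (phi ab.1) (phi ab.2) psi v == phi v) [:: ab.1, ab.2 & V].
Proof.
move/allP=> agree; apply/allP => v; rewrite !inE /put.
case: (eqVneq v ab.1) => [->|_] //=; case: (eqVneq v ab.2) => [-> //|_] /=.
exact: agree.
Qed.

(** Guided by [phi], a partial embedding is maintained that agrees with [phi] on the vertices of the
    free edges built so far. The end points of a forced edge are such vertices, so its query does
    join their images. *)
Lemma mark_embs (k : nat) (phi : nat -> int) (fs : seq (nat * nat)) (H : history) :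
  has (fun psi => all (fun v => psi v == phi v)
                    (verts [seq y <- trace k phi H | y \in fs]))
      (embs (mark fs (trace k phi H)) H).
Proof.
elim: H => [//|q H IHH]; rewrite /trace /=.
case E: (role k phi q) => [x|] /=; last first.
  by have [l ->] := embs_cons (mark fs (trace k phi H)) q H; rewrite has_cat IHH orbT.
rewrite -/(trace k phi H); have [] := role_joins E.
case: q {E} => e ans /= -> Jx _; case: ifP => [xfs|xNfs] /=.
  rewrite !has_cat !has_map; case/orP: Jx => /eqP -> /=; apply/orP; left; apply/orP;
    [left | right]; apply: sub_has IHH => psi; exact: put_agree.
case: ifP => [/and3P[_ x1 x2]|_] /=.
  rewrite has_cat; apply/orP; left.
  rewrite has_filter -filter_predI -has_filter.
  apply: sub_has IHH => psi /= /allP agree.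
  rewrite {1}/joins (eqP (agree _ x1)) (eqP (agree _ x2)) [X in _ && X]Jx andbT.
  by apply/allP.
by have [l ->] := embs_cons (mark fs (trace k phi H)) (e, true) H; rewrite has_cat IHH orbT.
Qed.

Lemma mem_pairs (k : nat) (ab : nat * nat) :
  (ab \in pairs k) = (ab.1 < ab.2 < k)%N.
Proof.
rewrite mem_filter; case: ab => a b /=; apply: andb_id2l => lab.
apply/allpairsP/idP => [[[c d] /= []]|lbk].
  by rewrite !mem_iota => _ + [_ ->].
by exists (a, b); rewrite !mem_iota /= !add0n (ltn_trans lab lbk).
Qed.

Lemma uniq_pairs (k : nat) : uniq (pairs k).
Proof.
by apply/filter_uniq/allpairs_uniq; rewrite ?iota_uniq // => -[a b] [c d] _ _ [-> ->].
Qed.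

Lemma uniq_trace (k : nat) (phi : nat -> int) (H : history) :
  uniq (unzip1 H) -> uniq (trace k phi H).
Proof.
elim: H => [//|q H IHH] /= /andP[qH /IHH uH].
rewrite /trace /=; case E: (role k phi q) => [x|] //=.
rewrite -/(trace k phi H) uH andbT; apply: contra qH.
rewrite mem_pmap => /mapP[q' q'H /esym E'].
have [_ Jq _] := role_joins E; have [_ Jq' _] := role_joins E'.
by rewrite (joins_inj Jq Jq'); apply: map_f.
Qed.

Lemma trace_perm (k : nat) (phi : nat -> int) (H : history) :
  {in [pred v | (v < k)%N] &, injective phi} -> uniq (unzip1 H) ->
  (forall ab, ab \in pairs k -> has (fun q => q.2 && joins phi ab q.1) H) ->
  perm_eq (trace k phi H) (pairs k).
Proof.
move=> inj_phi uH full; apply: uniq_perm (uniq_trace _ _ uH) (uniq_pairs k) _.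
move=> x; rewrite mem_pmap; apply/mapP/idP => [[q _ /esym /role_joins[] //]|xk].
have /hasP[q qH /andP[q2 Jx]] := full _ xk; exists q => //.
have : x \in [seq ab <- pairs k | joins phi ab q.1] by rewrite mem_filter Jx.
(* By injectivity of [phi], the query is the image of only one pair, so [ohead] in [role] returns
   [x]. *)
have : all (pred1 x) [seq ab <- pairs k | joins phi ab q.1].
  apply/allP => y; rewrite mem_filter => /andP[Jy yk] /=.
  move: xk yk; rewrite !mem_pairs => /andP[x12 x2] /andP[y12 y2].
  have x1 := ltn_trans x12 x2; have y1 := ltn_trans y12 y2.
  case: x y x12 y12 x1 x2 y1 y2 Jx Jy {full} => a b [c d] /= ab cd ak bk ck dk.
  have inj u v : (u < k)%N -> (v < k)%N -> phi u = phi v -> u = v by move=> *; apply: inj_phi.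
  rewrite /joins /= => /orP[] /eqP -> /orP[] /eqP[E1 E2].
  - by rewrite (inj _ _ ak ck E1) (inj _ _ bk dk E2).
  - by have := inj _ _ ak dk E1; have := inj _ _ bk ck E2; lia.
  - by have := inj _ _ bk ck E1; have := inj _ _ ak dk E2; lia.
  - by rewrite (inj _ _ bk dk E1) (inj _ _ ak ck E2).
rewrite /role q2; case: [seq _ <- _ | _] => [|y l] //= /andP[/eqP -> _] //.
Qed.

(** * Finite verification over all building orders *)

Lemma frees_mark (fs L : seq (nat * nat)) :
  uniq fs -> uniq L -> {subset fs <= L} -> frees (mark fs L) = size fs.
Proof.
move=> ufs uL sub; transitivity (count (mem fs) L).
  by elim: L {uL sub} => [//|x L IHL] /=; rewrite {}IHL; case: (x \in fs) => //; case: ifP.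
rewrite -size_filter; apply/perm_size/uniq_perm => [||x]; rewrite ?filter_uniq //.
by rewrite mem_filter; apply: andb_idr; exact: sub.
Qed.

(** The forced edges of [D] when [R] precedes [D]. Keeping [R] apart allows its order to be
    forgotten. *)
Fixpoint gain (fs D R : seq (nat * nat)) : nat :=
  if D is x :: D' then (closes fs (D' ++ R) x + gain fs D' R)%N else 0%N.

Lemma forceds_mark (fs L : seq (nat * nat)) : forceds (mark fs L) = gain fs L [::].
Proof.
elim: L => [//|x L IHL] /=; rewrite cats0 -{}IHL.
by case xfs: (x \in fs); [rewrite /closes xfs | case: (closes _ _ _)].
Qed.

Lemma mem_verts (L : seq (nat * nat)) (v : nat) :
  (v \in verts L) = has (fun x => v \in [:: x.1; x.2]) L.
Proof.
by apply/flatten_mapP/hasP => -[x]; exists x.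
Qed.

Lemma closes_sub (fs L L' : seq (nat * nat)) (x : nat * nat) :
  {subset L <= L'} -> closes fs L x -> closes fs L' x.
Proof.
move=> sub; rewrite /closes !mem_verts => /and3P[-> h1 h2] /=.
have sub' : {subset [seq y <- L | y \in fs] <= [seq y <- L' | y \in fs]}.
  by move=> y; rewrite !mem_filter => /andP[-> /sub].
by apply/andP; split; [move: h1 | move: h2] => /hasP[y /sub' yL hy];
  apply/hasP; exists y.
Qed.

Lemma closes_eqi (fs L L' : seq (nat * nat)) (x : nat * nat) :
  L =i L' -> closes fs L x = closes fs L' x.
Proof.
by move=> eqL; apply/idP/idP; apply: closes_sub => y; rewrite eqL.
Qed.

Lemma gain_eqi (fs D R R' : seq (nat * nat)) :
  R =i R' -> gain fs D R = gain fs D R'.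
Proof.
move=> eqR; elim: D => [//|x D IHD] /=; rewrite IHD; congr (nat_of_bool _ + _)%N.
by apply: closes_eqi => y; rewrite !mem_cat eqR.
Qed.

Lemma gain_cat (fs D' D R : seq (nat * nat)) :
  gain fs (D' ++ D) R = (gain fs D' (D ++ R) + gain fs D R)%N.
Proof. by elim: D' => [//|x D' IHD'] /=; rewrite catA IHD' addnA. Qed.

(** An edge closed by [R] stays closed when more edges precede it, so the order within [D] is
    irrelevant. *)
Lemma gain_all (fs D R : seq (nat * nat)) :
  all (closes fs R) D -> gain fs D R = size D.
Proof.
elim: D => [//|x D IHD] /= /andP[cx /IHD ->].
by rewrite (closes_sub _ cx) // => y yR; rewrite mem_cat yR orbT.
Qed.

Fixpoint subs (n : nat) (L : seq (nat * nat)) : seq (seq (nat * nat)) :=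
  match n, L with
  | 0%N, _ => [:: [::]]
  | _, [::] => [::]
  | n'.+1, x :: L' => [seq x :: fs | fs <- subs n' L'] ++ subs n L'
  end.

Lemma subsP (n : nat) (L fs : seq (nat * nat)) :
  reflect (subseq fs L /\ size fs = n) (fs \in subs n L).
Proof.
elim: L n fs => [|x L IHL] [|n] fs.
- by rewrite /= inE; apply: (iffP eqP) => [->|[/eqP]].
- by apply: (iffP idP) => // -[/eqP ->].
- rewrite inE; apply: (iffP eqP) => [->|[_ /size0nil] //]; by rewrite sub0seq.
- rewrite /= mem_cat; apply: (iffP orP) => [[/mapP[l /IHL[sl <-] ->]|/IHL[sl <-]]|].
  + by rewrite /= eqxx.
  + by split=> //; apply: subseq_trans sl (subseq_cons _ _).
  + case: fs => [[] //|y fs] /= [+ [sz]]; case: eqVneq => [-> sl|_ sl]; [left|right].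
      by apply: map_f; apply/IHL.
    by apply/IHL; split => //=; rewrite sz.
Qed.

(* [R] and then [D] have been built, in an order which is disregarded in [R];
   [rest] is still to come. *)
Definition settled (J : nat) (R D rest fs : seq (nat * nat)) : bool :=
  if all (mem (D ++ R)) fs then
    if all (closes fs (D ++ R)) rest then (J <= gain fs D R + size rest)%N
    else false
  else false.

(** Branches on the next edge to be built, and stops as soon as some candidate in [C] is settled.
    Running out of the fuel [n] gives [false], so soundness does not depend on its value. *)
Fixpoint search (n J : nat) (C : seq (seq (nat * nat)))
    (R D rest : seq (nat * nat)) : bool :=
  if has (settled J R D rest) C then true
  else if n is n'.+1 then
    if rest is [::] then false
    else all (fun x => search n' J C R (x :: D) (rem x rest)) rest
  else false.

Lemma search_sound (n J : nat) (C : seq (seq (nat * nat)))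
    (R R' D rest L : seq (nat * nat)) :
  search n J C R D rest -> R =i R' -> perm_eq L rest ->
  exists2 fs, fs \in C & (J <= gain fs (L ++ D) R')%N.
Proof.
move=> + eqR; elim: n D rest L => [|n IHn] D rest L /=;
  case: ifP => [/hasP[fs fsC]|_] //.
1,2: rewrite /settled; case: ifP => // _; case: ifP => // cl leJ _ eqL; exists fs => //;
  rewrite -(gain_eqi _ _ eqR) gain_cat gain_all ?(perm_size eqL) 1?addnC //;
  by rewrite (perm_all _ eqL).
(* As the latest edge comes first, the next edge to be built is the last element of [L]. *)
case: rest => // y rest'; set rest := y :: rest' => sr eqL.
case/lastP: L eqL => [/perm_size //|L x] eqL.
have xr : x \in rest by rewrite -(perm_mem eqL) mem_rcons mem_head.
rewrite cat_rcons; apply: IHn (allP sr x xr) _.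
have : perm_eq (rcons L x) (x :: rem x rest) := perm_trans eqL (perm_to_rem xr).
by rewrite perm_rcons perm_cons.
Qed.

(* Disregarding the order of the first [m] edges keeps the search small. *)
Definition check (m k F J : nat) : bool :=
  (m <= size (pairs k))%N &&
  let C := [seq fs <- subs F (pairs k) | all (mem (verts fs)) (iota 0 k)] in
  all (fun R => search (size (pairs k)) J C R [::] [seq x <- pairs k | x \notin R])
      (subs m (pairs k)).

Lemma check_sound (m k F J : nat) (L : seq (nat * nat)) :
  check m k F J -> perm_eq L (pairs k) ->
  exists2 fs, fs \in subs F (pairs k) & (J <= forceds (mark fs L))%N.
Proof.
case/andP=> lem ck eqL.
have uL : uniq L by rewrite (perm_uniq eqL) uniq_pairs.
(* The [m] earliest edges form the end of [L]; [R] is the same set in the order of [pairs k], as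
   enumerated by [subs]. *)
set j := (size L - m)%N; set R := [seq x <- pairs k | x \in drop j L].
have eqR : R =i drop j L.
  move=> x; rewrite mem_filter -(perm_mem eqL) andbC; apply: andb_idl; exact: mem_drop.
have szR : size R = m.
  rewrite (perm_size (uniq_perm (filter_uniq _ (uniq_pairs k)) (drop_uniq _ uL) eqR)).
  by rewrite size_drop subKn // (perm_size eqL).
have RC : R \in subs m (pairs k) by apply/subsP; split; [exact: filter_subseq | exact: szR].
have eqT : perm_eq (take j L) [seq x <- pairs k | x \notin R].
  apply: uniq_perm => [||x]; [exact: take_uniq | exact/filter_uniq/uniq_pairs |].
  rewrite mem_filter eqR -(perm_mem eqL) -{3}(cat_take_drop j L).
  move: uL; rewrite -{1}(cat_take_drop j L) cat_uniq => /and3P[_ /hasPn dis _].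
  rewrite mem_cat; case xd: (x \in drop j L) => /=; last by rewrite orbF.
  by apply/negbTE; apply: dis.
have [fs + leJ] := search_sound (allP ck R RC) eqR eqT.
rewrite mem_filter => /andP[_ fsC]; exists fs => //.
rewrite forceds_mark -(cat_take_drop j L) gain_cat cats0.
(* Forced edges among the first [m] are discarded, since their order is unknown to the search. *)
by rewrite cats0 in leJ; apply: leq_trans leJ (leq_addr _ _).
Qed.

(** * First moment bound on the winning probability *)

Definition patterns (k F J : nat) : seq pattern :=
  [seq P <- [seq mark fs L | L <- permutations (pairs k), fs <- subs F (pairs k)] |
     (frees P == F) && (J <= forceds P)%N].

(** The copy supplies the pattern: its edges in building order, marked with the free set given by
    [check_sound], admit an embedding by [mark_embs]. *)
Lemma has_copy_nembs (R : realType) (m k F J : nat) (h : history) :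
  check m k F J -> uniq (unzip1 h) -> has_copy (K k) h ->
  1 <= \sum_(P <- patterns k F J) nembs R P h.
Proof.
move=> ck uh [phi [inj_phi copy]].
(* Patterns live on natural numbers; [phi] is extended by the arbitrary value 0. *)
pose phi' v := if insub v is Some i then phi i else 0.
have phiE (i : 'I_k) : phi' i = phi i by rewrite /phi' valK.
have inj' : {in [pred v | (v < k)%N] &, injective phi'}.
  move=> a b /= ak bk; rewrite -[a]/(val (Ordinal ak)) -[b]/(val (Ordinal bk)).
  by rewrite !phiE => /inj_phi ->.
have uH : uniq (unzip1 (rev h)) by rewrite /unzip1 map_rev rev_uniq.
have full ab : ab \in pairs k -> has (fun q => q.2 && joins phi' ab q.1) (rev h).
  rewrite mem_pairs has_rev; case: ab => a b /= /andP[ab bk].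
  have ak := ltn_trans ab bk.
  have /copy : @adj (K k) (Ordinal ak) (Ordinal bk).
    by rewrite /= /complete_rel -val_eqE /= neq_ltn ab.
  by rewrite /built -!phiE /=.
have eqL := trace_perm inj' uH full.
set L := trace k phi' (rev h) in eqL.
have [fs fsC leJ] := check_sound ck eqL.
have [sfs szfs] := subsP _ _ _ fsC.
have PP : mark fs L \in patterns k F J.
  rewrite mem_filter leJ andbT (frees_mark (subseq_uniq sfs (uniq_pairs k))).
  - by rewrite szfs eqxx /=; apply: allpairs_f => //; rewrite mem_permutations.
  - by rewrite (perm_uniq eqL) uniq_pairs.
  - by move=> x /(mem_subseq sfs); rewrite (perm_mem eqL).
rewrite (big_rem _ PP) /=; apply: ler_wpDr.
  by apply: sumr_ge0 => P _; rewrite ler0n.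
rewrite /nembs ler1n; have := mark_embs k phi' fs (rev h).
by rewrite -/L; case: (embs _ _).
Qed.

(** Union bound over [patterns k F J], a finite list independent of [p] and [N]. Forced edges beyond
    [J] only lower the bound, as [p <= 1]. *)
Lemma win_prob_le (R : realType) (m k F J : nat) (p : R) (s : strategy) (N : nat) :
  check m k F J -> 0 <= p <= 1 ->
  win_prob (K k) p s N <=
  (size (patterns k F J))%:R * ((2 * p * N%:R) ^+ F * p ^+ J).
Proof.
move=> ck p01; have /andP[p0 p1] := p01; rewrite win_probE.
apply: (@le_trans _ _ (expect p s N (fun h => \sum_(P <- patterns k F J) nembs R P h) [::])).
  apply: expect_le => // h uh; rewrite /wins; case: asboolP => [cp|_].
    exact: has_copy_nembs ck uh cp.
  by apply: sumr_ge0 => P _; rewrite ler0n.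
rewrite expect_sum mulr_natl -iter_addr_0 -count_predT -big_const_seq.
rewrite big_seq [X in _ <= X]big_seq; apply: ler_sum => P.
rewrite mem_filter => /andP[/andP[/eqP <- leJ] _].
apply: le_trans (expect_nembs _ _ _ p01) _.
rewrite ler_wpM2l ?exprn_ge0 ?mulr_ge0 //.
exact: ler_wiXn2l.
Qed.

Lemma check_K3 : check 2 3 2 1. Proof. by vm_compute. Qed.

(** Behind the computation: the two edges missing from the first four meet at most two of the three
    perfect matchings, so these four contain a perfect matching. Taken as free, it forces the last
    two edges. *)
Lemma check_K4 : check 4 4 2 2. Proof. by vm_compute. Qed.

(** At most two of the seven edges that are not free are disregarded. *)
Lemma check_K5 : check 4 5 3 5. Proof. by vm_compute. Qed.

Lemma powR_root (R : realType) (p : R) (a b : nat) :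
  0 < p -> (0 < b)%N -> (p `^ (a%:R / b%:R)) ^+ b = p ^+ a.
Proof.
move=> p0 b0; rewrite -powR_mulrn ?powR_ge0 // -powRrM divfK ?powR_mulrn ?ltW //.
by rewrite pnatr_eq0 -lt0n.
Qed.

Lemma f_ge (R : realType) (m k F J : nat) :
  check m k F J -> (0 < F)%N ->
  exists2 c : R, 0 < c & forall p : R, 0 < p < 1 ->
    ((c * p `^ (- ((F + J)%:R / F%:R)))%:E <= f (K k) p)%E.
Proof.
(* The successor keeps [A] positive. In [c], a factor [2 ^+ F] comes from the two orientations of
   each free edge, and one more 2 from the winning probability one half. *)
move=> ck F0; set A := (size (patterns k F J)).+1.
pose c : R := (A%:R * 2 ^+ F.+1)^-1.
have D1 : 1 <= A%:R * 2 ^+ F.+1 :> R.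
  by rewrite -natrX -natrM ler1n muln_gt0 expn_gt0.
have c0 : 0 < c by rewrite invr_gt0 (lt_le_trans ltr01).
have c1 : c <= 1 by rewrite invf_le1 // (lt_le_trans ltr01).
exists c => // p /andP[p0 p1]; apply/ereal_infP => _ [N [s win] <-].
rewrite lee_fin powRN.
set y := p `^ _; have y0 : 0 < y by apply: powR_gt0.
have yF : y ^+ F = p ^+ (F + J) by apply: powR_root.
rewrite ler_pdivrMr //.
(* Raising to the power [F] clears the denominator of the exponent; then [c ^+ F <= c] because
   [c <= 1]. *)
rewrite -(ler_pXn2r F0) ?nnegrE ?mulr_ge0 ?(ltW c0) ?(ltW y0) //.
apply: (@le_trans _ _ c); first by rewrite -[leRHS]expr1 ler_wiXn2l // ltW.
have p01 : 0 <= p <= 1 by rewrite !ltW.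
have := le_trans win (win_prob_le s N ck p01).
set z := (N%:R * y) ^+ F.
have -> : (2 * p * N%:R) ^+ F * p ^+ J = 2 ^+ F * z.
  by rewrite /z !exprMn yF exprD; ring.
have z0 : 0 <= z by rewrite exprn_ge0 ?mulr_ge0 // ltW.
have le_z : (size (patterns k F J))%:R * (2 ^+ F * z) <= A%:R * (2 ^+ F * z).
  by apply: ler_wpM2r; [exact: mulr_ge0 (exprn_ge0 _ _) z0 | rewrite ler_nat].
move=> /le_trans /(_ le_z) half_le.
rewrite /c -div1r ler_pdivrMr ?(lt_le_trans ltr01) // exprS.
have -> : z * (A%:R * (2 * 2 ^+ F)) = 2 * (A%:R * (2 ^+ F * z)) by ring.
by move: half_le; lra.
Qed.

(** * Upper bounds *)

Definition upd (T : eqType) (w : T -> bool) (e : T) (b : bool) : T -> bool :=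
  fun x => if x == e then b else w x.

Lemma updC (T : eqType) (w : T -> bool) (x e : T) (c b : bool) :
  x != e -> upd (upd w x c) e b = upd (upd w e b) x c.
Proof.
move=> xe; apply: funext => y; rewrite /upd.
by case: (eqVneq y e) => // ->; rewrite eq_sym (negbTE xe).
Qed.

Lemma updK (T : eqType) (w : T -> bool) (e : T) (c b : bool) :
  upd (upd w e c) e b = upd w e b.
Proof. by apply: funext => y; rewrite /upd; case: eqP. Qed.

(* The expectation of [G] when each element of [U] is independently open with
   probability [p] and the state of the other elements is given by [w]. *)
Fixpoint avg (R : realType) (T : eqType) (p : R) (U : seq T)
    (G : (T -> bool) -> R) (w : T -> bool) : R :=
  if U is e :: U' then
    p * avg p U' G (upd w e true) + (1 - p) * avg p U' G (upd w e false)
  else G w.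

Lemma avgD (R : realType) (T : eqType) (p : R) (U : seq T)
    (F G : (T -> bool) -> R) (w : T -> bool) :
  avg p U (fun w => F w + G w) w = avg p U F w + avg p U G w.
Proof. by elim: U w => [//|e U IHU] w /=; rewrite !IHU; ring. Qed.

Lemma avgZ (R : realType) (T : eqType) (p : R) (U : seq T) (c : R)
    (G : (T -> bool) -> R) (w : T -> bool) :
  avg p U (fun w => c * G w) w = c * avg p U G w.
Proof. by elim: U w => [//|e U IHU] w /=; rewrite !IHU; ring. Qed.

Lemma avg_const (R : realType) (T : eqType) (p : R) (U : seq T) (c : R)
    (w : T -> bool) : avg p U (fun=> c) w = c.
Proof. by elim: U w => [//|e U IHU] w /=; rewrite !IHU; ring. Qed.

Lemma avg_sum (R : realType) (T : eqType) (p : R) (U : seq T) (I : Type)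
    (r : seq I) (P : pred I) (F : I -> (T -> bool) -> R) (w : T -> bool) :
  avg p U (fun w => \sum_(i <- r | P i) F i w) w =
  \sum_(i <- r | P i) avg p U (F i) w.
Proof.
by elim: U w => [//|e U IHU] w /=; rewrite !IHU !mulr_sumr -big_split.
Qed.

Lemma avg_le (R : realType) (T : eqType) (p : R) (U : seq T)
    (F G : (T -> bool) -> R) (w : T -> bool) :
  0 <= p <= 1 -> (forall w, F w <= G w) -> avg p U F w <= avg p U G w.
Proof.
move=> /andP[p0 p1] leFG; elim: U w => [//|e U IHU] w /=.
by rewrite lerD // ler_wpM2l ?subr_ge0.
Qed.

Lemma avg_upd (R : realType) (T : eqType) (p : R) (U : seq T)
    (G : (T -> bool) -> R) (e : T) (b : bool) (w : T -> bool) :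
  e \notin U -> avg p U (fun w => G (upd w e b)) w = avg p U G (upd w e b).
Proof.
elim: U w => [//|x U IHU] w /=; rewrite inE negb_or => /andP[ex eU].
by rewrite !IHU // !(@updC _ w x) // eq_sym.
Qed.

(** Any element of [U] may be revealed first, which lets an adaptive sequence of queries be compared
    with the fixed list [U]. *)
Lemma avg_split (R : realType) (T : eqType) (p : R) (U : seq T)
    (G : (T -> bool) -> R) (e : T) (w : T -> bool) :
  uniq U -> e \in U ->
  avg p U G w = p * avg p U (fun w => G (upd w e true)) w +
                (1 - p) * avg p U (fun w => G (upd w e false)) w.
Proof.
elim: U w => [//|x U IHU] w /= /andP[xU uU]; rewrite inE => /predU1P[->|eU].
  by rewrite !avg_upd // !updK; ring.
by rewrite !IHU //; ring.
Qed.

Lemma avg_all (R : realType) (T : eqType) (p : R) (U D : seq T) (w : T -> bool) :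
  uniq U -> uniq D -> {subset D <= U} ->
  avg p U (fun w => (all w D)%:R) w = p ^+ size D.
Proof.
move=> uU; elim: D => [|e D IHD] /=; first by rewrite avg_const.
move=> /andP[eD uD] sub.
rewrite (avg_split _ _ _ uU (sub e (mem_head _ _))).
have allE b : (fun w => (upd w e b e && all (upd w e b) D)%:R : R) =
              (fun w => (b && all w D)%:R).
  apply: funext => w'; rewrite {1}/upd eqxx; congr (_ && _)%:R.
  apply: eq_in_all => x xD; rewrite /upd; case: eqP => // xe.
  by rewrite -xe xD in eD.
rewrite !allE /= avg_const IHD //; first by rewrite exprS; ring.
by move=> x xD; apply: sub; rewrite inE xD orbT.
Qed.

(** * The greedy strategy, coupled with a random graph *)

Definition found (h : history) (e : epair) : bool := (e, true) \in h.

(** The coupling: queried pairs take their answer from [h], the others their state in [w]. *)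
Definition merge (h : history) (w : epair -> bool) (e : epair) : bool :=
  if e \in unzip1 h then found h e else w e.

Lemma found_unzip1 (h : history) (e : epair) : found h e -> e \in unzip1 h.
Proof. exact: (map_f fst). Qed.

Lemma merge_rcons (h : history) (e : epair) (b : bool) (w : epair -> bool) :
  e \notin unzip1 h -> merge (rcons h (e, b)) w = merge h (upd w e b).
Proof.
move=> eh; apply: funext => x; rewrite /merge /found /upd.
rewrite /unzip1 map_rcons !mem_rcons !inE xpair_eqE /=.
case: (eqVneq x e) => [->|_] //=; rewrite (negbTE eh).
have /negbTE -> : (e, true) \notin h by apply: contra eh => /(map_f fst).
by case: b.
Qed.

Lemma built_rcons (h : history) (q : epair * bool) (u v : int) :
  built h u v -> built (rcons h q) u v.
Proof. by rewrite /built has_rcons => ->; rewrite orbT. Qed.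

Lemma expect_wins (R : realType) (H : sgraph) (p : R) (s : strategy) (n : nat)
    (h : history) :
  has_copy H h -> expect p s n (wins R H) h = 1.
Proof.
elim: n h => [|n IHn] h cp; first by rewrite /= /wins asboolT.
have cpS q : has_copy H (rcons h q).
  by case: cp => phi [inj cp]; exists phi; split=> // x y /cp; exact: built_rcons.
by rewrite /= /step !IHn //; ring.
Qed.

Definition pair0 : epair := Sub (0%Z, 1%Z) (erefl : (0%Z, 1%Z).1 < (0%Z, 1%Z).2).

Definition mkpair (u v : int) : epair := insubd pair0 (u, v).

Lemma val_mkpair (u v : int) : u < v -> \val (mkpair u v) = (u, v).
Proof. by move=> uv; rewrite val_insubd /= uv. Qed.

(** The second end point exceeds those of all pairs in [l]. Such a pair fills the turns in which no
    useful query is left. *)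
Definition unused (l : seq epair) : epair :=
  mkpair 0 (\sum_(e <- l) `|(\val e).2|%N).+1%:Z.

Lemma unusedP (l : seq epair) : unused l \notin l.
Proof.
apply/negP => /(perm_to_rem) eql.
have : (\sum_(e <- l) `|(\val e).2| =
  `|(\val (unused l)).2| + \sum_(e <- rem (unused l) l) `|(\val e).2|)%N.
  by rewrite (perm_big _ eql) big_cons.
rewrite {1}/unused val_mkpair //=; lia.
Qed.

Definition greedy_query (Q : (epair -> bool) -> seq epair) (h : history) : epair :=
  if [seq e <- Q (found h) | e \notin unzip1 h] is e :: _ then e
  else unused (unzip1 h).

Lemma greedy_fresh (Q : (epair -> bool) -> seq epair) (h : history) :
  greedy_query Q h \notin unzip1 h.
Proof.
rewrite /greedy_query; case E: [seq _ <- _ | _] => [|e l]; first exact: unusedP.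
have : e \in [seq e <- Q (found h) | e \notin unzip1 h] by rewrite E mem_head.
by rewrite mem_filter => /andP[].
Qed.

Definition greedy (Q : (epair -> bool) -> seq epair) : strategy :=
  Strategy (greedy_fresh Q).

(* [Q w] lists the queries which are worth making in the light of the open
   pairs [w]; Builder makes them as long as one is left. *)
Lemma greedy_wins (R : realType) (H : sgraph) (p : R) (U : seq epair)
    (Q : (epair -> bool) -> seq epair) (X : (epair -> bool) -> bool) :
  0 <= p <= 1 -> uniq U ->
  (forall w, {subset Q w <= U}) -> (forall w, uniq (Q w)) ->
  (forall w w' : epair -> bool, (forall e, w e -> w' e) -> {subset Q w <= Q w'}) ->
  (forall w w' : epair -> bool, (forall e, e \in Q w -> w' e -> w e) -> X w' -> X w) ->
  (forall h, X (found h) -> has_copy H h) ->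
  forall n w0,
  avg p U (fun w => (X w && (size (Q w) <= n)%N)%:R) w0 <=
  expect p (greedy Q) n (wins R H) [::].
Proof.
move=> /[dup] p01 /andP[p0 p1] uU QU uQ monoQ closedX Xwins n w0.
(* The position [h] with [n] turns left: the budget covers all of [Q], so past queries are added to
   it. *)
pose G n h w : R := (X (merge h w) && (size (Q (merge h w)) <= n + size h)%N)%:R.
have le_merge h (w : epair -> bool) e : found h e -> merge h w e.
  by move=> fe; rewrite /merge found_unzip1.
(* When no useful query is left, either a copy has been built, or [closedX] shows that no completion
   of [h] satisfies [X]. *)
have stuck m h : [seq e <- Q (found h) | e \notin unzip1 h] = [::] ->
    avg p U (G m h) w0 <= expect p (greedy Q) m (wins R H) h.
  move=> E; case: (pselect (has_copy H h)) => [cp|ncp].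
    rewrite expect_wins // -[leRHS](avg_const p U 1 w0); apply: avg_le => // w.
    by rewrite lern1 leq_b1.
  apply: (@le_trans _ _ 0); last first.
    elim: m h {E ncp} => [|m IHm] h /=.
      by rewrite /wins ler0n.
    by rewrite /step addr_ge0 // mulr_ge0 ?subr_ge0 ?IHm.
  rewrite -(avg_const p U 0 w0); apply: avg_le => // w.
  rewrite /G (_ : X _ = false) //; apply/negP => Xm; apply/ncp/Xwins.
  apply: closedX Xm => e eQ; rewrite /merge; case: ifP => // /negbT eh.
  have : e \in [seq e <- Q (found h) | e \notin unzip1 h] by rewrite mem_filter eh.
  by rewrite E.
(* The invariant says that every query made so far was worth making. *)
suff gen m h : uniq (unzip1 h) -> {subset unzip1 h <= Q (found h)} ->
    avg p U (G m h) w0 <= expect p (greedy Q) m (wins R H) h.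
  have := gen n [::] isT; rewrite /G (_ : merge [::] = id) //=.
  by rewrite addn0; apply.
elim: m h => [|m IHm] h uh subh;
  case E: [seq e <- Q (found h) | e \notin unzip1 h] => [|e l]; try exact: stuck.
  have : e \in [seq e <- Q (found h) | e \notin unzip1 h] by rewrite E mem_head.
  rewrite mem_filter => /andP[eh eQ].
  (* No turn is left while [e] is still useful: together with the past queries it exceeds the
     budget, so the indicator vanishes. *)
  apply: (@le_trans _ _ 0); last by rewrite /= /wins ler0n.
  rewrite -(avg_const p U 0 w0); apply: avg_le => // w; rewrite /G add0n.
  rewrite leqNgt (_ : (_ < _)%N) ?andbF //.
  have sub : {subset e :: unzip1 h <= Q (merge h w)}.
    by move=> x; rewrite inE => /predU1P[->|/subh xQ]; apply: (monoQ _ _ (le_merge h w)).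
  by have := uniq_leq_size _ sub; rewrite /= size_map eh; apply.
have : e \in [seq e <- Q (found h) | e \notin unzip1 h] by rewrite E mem_head.
rewrite mem_filter => /andP[eh eQ].
have sE : greedy Q h = e by rewrite /= /greedy_query E.
have GE b : (fun w => G m.+1 h (upd w e b)) = G m (rcons h (e, b)).
  by apply: funext => w; rewrite /G merge_rcons // size_rcons addnS.
rewrite (avg_split _ _ _ uU (QU _ _ eQ)) !GE /= /step sE.
have found_le b x : found h x -> found (rcons h (e, b)) x.
  by rewrite /found mem_rcons inE => ->; rewrite orbT.
have IH b : avg p U (G m (rcons h (e, b))) w0 <=
    expect p (greedy Q) m (wins R H) (rcons h (e, b)).
  apply: IHm; first by rewrite /unzip1 map_rcons rcons_uniq eh.
  move=> x; rewrite /unzip1 map_rcons mem_rcons inE => /predU1P[->|/subh xQ];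
    exact: (monoQ _ _ (found_le b)).
by rewrite lerD // ler_wpM2l ?subr_ge0.
Qed.

(** * Transversal cliques on a board split into parts *)

(* The board is split into [k] parts of [M.+1] vertices; a transversal picks
   one vertex in each. *)
Definition transv (k M : nat) : Type := {ffun 'I_k -> 'I_M.+1}.

Definition point (k M : nat) (t : transv k M) (i : 'I_k) : int :=
  (i * M.+1 + t i)%N%:Z.

Definition edge (k M : nat) (t : transv k M) (x : 'I_k * 'I_k) : epair :=
  mkpair (point t x.1) (point t x.2).

Lemma point_inj (k M : nat) (t t' : transv k M) (i i' : 'I_k) :
  point t i = point t' i' -> i = i' /\ t i = t' i'.
Proof.
move=> [E]; have [lt lt'] := (ltn_ord (t i), ltn_ord (t' i')).
have := congr1 (divn^~ M.+1) E; have := congr1 (modn^~ M.+1) E.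
rewrite !modnMDl !divnMDl // !modn_small // !divn_small // !addn0 => e1 e2.
by split; apply: val_inj.
Qed.

Lemma point_lt (k M : nat) (t : transv k M) (x : 'I_k * 'I_k) :
  (x.1 < x.2)%N -> point t x.1 < point t x.2.
Proof.
move=> lt; rewrite /point ltz_nat.
have := ltn_ord (t x.1); have : (x.1.+1 * M.+1 <= x.2 * M.+1)%N by rewrite leq_mul2r lt orbT.
by rewrite mulSn; lia.
Qed.

Lemma edge_inj (k M : nat) (t t' : transv k M) (x x' : 'I_k * 'I_k) :
  (x.1 < x.2)%N -> (x'.1 < x'.2)%N -> edge t x = edge t' x' ->
  [/\ x = x', t x.1 = t' x'.1 & t x.2 = t' x'.2].
Proof.
move=> ltx ltx' /(congr1 val); rewrite !val_mkpair ?point_lt // => -[] E1 E2.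
have [e1 e1'] := point_inj (congr1 Posz E1); have [e2 e2'] := point_inj (congr1 Posz E2).
by split=> //; case: x x' e1 e2 {ltx ltx' E1 E2 e1' e2'} => a b [c d] /= -> ->.
Qed.

Definition up (k : nat) (A : pred ('I_k * 'I_k)) : pred ('I_k * 'I_k) :=
  [pred x : 'I_k * 'I_k | (x.1 < x.2)%N & A x].

Definition edges (k M : nat) (A : pred ('I_k * 'I_k)) (t : transv k M) : seq epair :=
  [seq edge t x | x <- enum (up A)].

Lemma uniq_edges (k M : nat) (A : pred ('I_k * 'I_k)) (t : transv k M) :
  uniq (edges A t).
Proof.
rewrite map_inj_in_uniq ?enum_uniq // => x y.
by rewrite !mem_enum !inE => /andP[lx _] /andP[ly _] /(edge_inj lx ly)[].
Qed.

Lemma size_edges (k M : nat) (A : pred ('I_k * 'I_k)) (t : transv k M) :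
  size (edges A t) = #|up A|.
Proof. by rewrite size_map cardE. Qed.

(** Index pairs that are not increasing contribute only the default [pair0]; a duplicate-free list
    containing every possible useful query is enough. *)
Definition board (k M : nat) : seq epair :=
  undup [seq edge x.1 x.2 | x <- enum {: transv k M * ('I_k * 'I_k)}].

Lemma edge_board (k M : nat) (t : transv k M) (x : 'I_k * 'I_k) :
  edge t x \in board k M.
Proof. by rewrite mem_undup; apply/mapP; exists (t, x); rewrite ?mem_enum. Qed.

Lemma edges_board (k M : nat) (A : pred ('I_k * 'I_k)) (t : transv k M) :
  {subset edges A t <= board k M}.
Proof. by move=> e /mapP[x _ ->]; apply: edge_board. Qed.

(** All parts have the same width [M.+1], which keeps [transv] a plain function type; the size
    actually used is [n l]. *)
Definition parts (k M : nat) (n : nat -> nat) : {pred transv k M} :=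
  family (fun l : 'I_k => [pred a : 'I_M.+1 | (a < n l)%N]).

Definition clique (k M : nat) (n : nat -> nat) (w : epair -> bool) : bool :=
  [exists t in @parts k M n, all w (edges predT t)].

(* Before the pair [(i, j)] is queried, its end points must be joined to a
   common clique meeting the first [i] parts. *)
Definition before (k : nat) (i j : 'I_k) : pred ('I_k * 'I_k) :=
  fun x => (x.1 < i)%N && ((x.2 <= i)%N || (x.2 == j)).

Definition involved (k : nat) (i j l : 'I_k) : bool := (l <= i)%N || (l == j).

(** Choices in parts that are not involved are pinned to [ord0], so that each partial transversal is
    counted once. *)
Definition partials (k M : nat) (n : nat -> nat) (i j : 'I_k) : {pred transv k M} :=
  family (fun l : 'I_k =>
    [pred a : 'I_M.+1 | if involved i j l then (a < n l)%N else a == ord0]).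

Definition needed (k M : nat) (n : nat -> nat) (w : epair -> bool) : seq epair :=
  undup [seq edge x.2 x.1 | x <- enum [pred x : ('I_k * 'I_k) * transv k M |
    [&& (x.1.1 < x.1.2)%N, x.2 \in @partials k M n x.1.1 x.1.2 &
        all w (edges (before x.1.1 x.1.2) x.2)]]].

Lemma needed_mono (k M : nat) (n : nat -> nat) (w w' : epair -> bool) :
  (forall e, w e -> w' e) -> {subset needed k M n w <= needed k M n w'}.
Proof.
move=> le e; rewrite !mem_undup => /mapP[x + ->]; rewrite mem_enum => /and3P[? ? cl].
apply/mapP; exists x => //; rewrite mem_enum; apply/and3P; split=> //.
exact: sub_all cl.
Qed.

Lemma needed_board (k M : nat) (n : nat -> nat) (w : epair -> bool) :
  {subset needed k M n w <= board k M}.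
Proof. by move=> e; rewrite mem_undup => /mapP[x _ ->]; apply: edge_board. Qed.

(** Induction on the lower part of an edge of a clique of [w']: the edges required before it are
    already open in [w], so it is needed, and hence open in [w] too. *)
Lemma clique_closed (k M : nat) (n : nat -> nat) (w w' : epair -> bool) :
  (forall e, e \in needed k M n w -> w' e -> w e) ->
  clique k M n w' -> clique k M n w.
Proof.
move=> closed /existsP[t /andP[tn /allP cl]]; apply/existsP; exists t; rewrite tn /=.
have edge_w' (x : 'I_k * 'I_k) : (x.1 < x.2)%N -> w' (edge t x).
  by move=> lx; apply: cl; apply: map_f; rewrite mem_enum inE lx.
suff open m (x : 'I_k * 'I_k) : (x.1 < m)%N -> (x.1 < x.2)%N -> w (edge t x).
  by apply/allP => e /mapP[x]; rewrite mem_enum => /andP[lx _] ->; apply: (open x.1.+1).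
elim: m x => [//|m IHm] [i j] /=; rewrite ltnS => im ij.
(* Resetting the other parts puts the transversal in [partials] without changing the edges between
   involved parts. *)
pose t' : transv k M := [ffun l => if involved i j l then t l else ord0].
have t'E (y : 'I_k * 'I_k) : involved i j y.1 -> involved i j y.2 -> edge t' y = edge t y.
  by rewrite /edge /point !ffunE => -> ->.
rewrite -t'E /involved ?leqnn ?eqxx ?orbT //.
apply: closed; last by rewrite t'E /involved ?leqnn ?eqxx ?orbT // edge_w'.
rewrite mem_undup; apply/mapP; exists ((i, j), t') => //.
rewrite mem_enum; apply/and3P; split=> //=.
  apply/familyP => l; rewrite !inE ffunE; case: ifP => inv; rewrite inv ?eqxx //.
  by have /familyP/(_ l) := tn; rewrite inE.
apply/allP => e /mapP[y]; rewrite mem_enum => /and3P[/= ly y1 y2] ->.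
rewrite t'E /involved ?(ltnW y1) //; apply: IHm => //.
exact: leq_trans y1 im.
Qed.

Lemma clique_copy (k M : nat) (n : nat -> nat) (h : history) :
  clique k M n (found h) -> has_copy (K k) h.
Proof.
move=> /existsP[t /andP[_ /allP cl]]; exists (point t); split.
  by move=> i j /point_inj[].
have open (i j : 'I_k) : (i < j)%N -> built h (point t i) (point t j).
  move=> ij; have fe : (edge t (i, j), true) \in h.
    by apply: cl; apply: map_f; rewrite mem_enum inE ij.
  apply/hasP; exists (edge t (i, j), true) => //=.
  by rewrite val_mkpair ?eqxx ?(@point_lt _ _ t (i, j)).
move=> i j /=; rewrite /complete_rel neq_ltn => /orP[/open//|/open].
by move=> /hasP[q qh q2]; apply/hasP; exists q => //; rewrite orbC.
Qed.

(** * Moment estimates for cliques and needed queries *)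

(** Chebyshev's inequality: [(N w / mu - 1) ^+ 2] equals 1 wherever [X] fails, since [N] vanishes
    there. *)
Lemma avg_second_moment (R : realType) (T : eqType) (p : R) (U : seq T)
    (N : (T -> bool) -> R) (X : (T -> bool) -> bool) (mu eps : R) (w : T -> bool) :
  0 <= p <= 1 -> 0 < mu -> (forall w, ~~ X w -> N w = 0) ->
  avg p U N w = mu -> avg p U (fun w => N w ^+ 2) w <= mu ^+ 2 * (1 + eps) ->
  avg p U (fun w => (~~ X w)%:R) w <= eps.
Proof.
move=> p01 mu0 X0 EN EN2.
pose Z w := mu ^- 2 * N w ^+ 2 + (- 2 * mu^-1 * N w + 1).
apply: (@le_trans _ _ (avg p U Z w)).
  apply: avg_le => // w'; have -> : Z w' = (N w' / mu - 1) ^+ 2.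
    by rewrite /Z; field; apply: lt0r_neq0.
  case: (boolP (X w')) => [_|/X0 ->] /=; first exact: sqr_ge0.
  by rewrite mul0r sub0r sqrrN expr1n.
rewrite /Z avgD avgD !avgZ avg_const EN mulfVK ?lt0r_neq0 //.
have : mu ^- 2 * avg p U (fun w => N w ^+ 2) w <= mu ^- 2 * (mu ^+ 2 * (1 + eps)).
  by rewrite ler_wpM2l // invr_ge0 exprn_ge0 // ltW.
rewrite mulrA mulVf ?expf_neq0 ?lt0r_neq0 //; lra.
Qed.

Lemma avg_markov (R : realType) (T : eqType) (p : R) (U : seq T)
    (Q : (T -> bool) -> nat) (N : nat) (w : T -> bool) :
  0 <= p <= 1 ->
  N.+1%:R * avg p U (fun w => (N < Q w)%N%:R) w <= avg p U (fun w => (Q w)%:R) w.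
Proof.
move=> p01; rewrite -avgZ; apply: avg_le => // w'.
by case: ltnP => lt; rewrite ?mulr0 ?ler0n // mulr1 ler_nat.
Qed.

Lemma sum_ord_lt (R : realType) (M m : nat) :
  (m <= M)%N -> \sum_(a < M | (a < m)%N) (1 : R) = m%:R.
Proof.
by move=> le; rewrite (big_ord_narrow le) sumr_const card_ord.
Qed.

Definition inside (k : nat) (S : {set 'I_k}) : pred ('I_k * 'I_k) :=
  fun x => (x.1 \in S) && (x.2 \in S).

(** The indicator that [t] and [t'] coincide on [S], in product form so that its sum over [t']
    factorises over the parts. *)
Definition agrees (R : realType) (k M : nat) (S : {set 'I_k}) (t t' : transv k M) : R :=
  \prod_(l < k) ((l \in S) ==> (t' l == t l))%:R.

Lemma agrees_ge0 (R : realType) (k M : nat) (S : {set 'I_k}) (t t' : transv k M) :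
  0 <= agrees R S t t'.
Proof. by apply: prodr_ge0 => l _; rewrite ler0n. Qed.

Lemma sum_parts (R : realType) (k M : nat) (n : nat -> nat)
    (G : 'I_k -> 'I_M.+1 -> R) :
  \sum_(t in @parts k M n) \prod_(l < k) G l (t l) =
  \prod_(l < k) \sum_(a < M.+1 | (a < n l)%N) G l a.
Proof. by rewrite bigA_distr_big_dep. Qed.

Lemma sum_agrees (R : realType) (k M : nat) (n : nat -> nat) (S : {set 'I_k})
    (t : transv k M) :
  (forall l, n l <= M.+1)%N -> t \in parts n ->
  \sum_(t' in @parts k M n) agrees R S t t' =
  \prod_(l < k) (if l \in S then 1 else (n l)%:R).
Proof.
move=> nM /familyP tn.
rewrite (sum_parts n (fun l a => ((l \in S) ==> (a == t l))%:R)); apply: eq_bigr => l _.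
case: ifP => lS; last by rewrite -(sum_ord_lt R (nM l)).
rewrite (bigD1 (t l)) ?eqxx /=; last by have := tn l; rewrite inE.
rewrite big1 ?addr0 // => a /andP[_ /negbTE ->] //.
Qed.

Lemma card_parts (R : realType) (k M : nat) (n : nat -> nat) :
  (forall l, n l <= M.+1)%N ->
  (#|@parts k M n|)%:R = \prod_(l < k) (n l)%:R :> R.
Proof.
move=> nM; rewrite -sum1_card natr_sum.
transitivity (\sum_(t in @parts k M n) \prod_(l < k) (1 : R)).
  by apply: eq_bigr => t _; rewrite big1.
by rewrite (sum_parts n (fun _ _ => 1)); apply: eq_bigr => l _; rewrite sum_ord_lt.
Qed.

(** The two edge sets share exactly the pairs inside the set of parts where [t] and [t'] agree. The
    power of [p] on the left avoids a subtraction in the exponent. *)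
Lemma avg_edges2 (R : realType) (k M : nat) (p : R) (t t' : transv k M)
    (w0 : epair -> bool) :
  avg p (board k M) (fun w => (all w (edges predT t))%:R * (all w (edges predT t'))%:R) w0 *
    p ^+ #|up (inside [set l | t l == t' l])| = p ^+ #|up (@predT ('I_k * 'I_k))| ^+ 2.
Proof.
set S := [set l | t l == t' l]; set E := edges predT t; set E' := edges predT t'.
have -> : (fun w => (all w E)%:R * (all w E')%:R) =
          (fun w => (all w (E ++ [seq e <- E' | e \notin E]))%:R :> R).
  apply: funext => w; rewrite -natrM mulnb all_cat; congr (_%:R)%R.
  case: (boolP (all w E)) => //= /allP wE; congr nat_of_bool.
  apply/allP/allP => h e; first by rewrite mem_filter => /andP[_]; exact: h.
  by move=> eE'; case: (boolP (e \in E)) => [/wE //|eE]; apply: h; rewrite mem_filter eE.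
rewrite avg_all ?undup_uniq //; last 2 first.
- rewrite cat_uniq !uniq_edges filter_uniq ?uniq_edges // andbT /=.
  by apply/hasPn => e; rewrite mem_filter => /andP[].
- by move=> e; rewrite mem_cat mem_filter => /orP[|/andP[_]]; exact: edges_board.
rewrite -exprD -exprM size_cat size_edges size_filter count_map -addnA muln2 -addnn.
congr (_ ^+ (_ + _)).
have -> : #|up (inside S)| = count (inside S) (enum (up (@predT ('I_k * 'I_k)))).
  rewrite cardE -size_filter; apply/perm_size/uniq_perm => [||x].
  - exact: enum_uniq.
  - exact/filter_uniq/enum_uniq.
  - by rewrite [RHS]mem_filter !mem_enum !inE andbT andbC.
rewrite cardE -(count_predC (inside S)) addnC; congr addn.
apply: eq_in_count => x; rewrite mem_enum => /andP[lx _] /=; congr negb.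
apply/mapP/andP => [[y]|[]]; rewrite ?inE.
  rewrite mem_enum => /andP[ly _] /(edge_inj lx ly)[<- e1 e2].
  by rewrite e1 e2 !eqxx.
move=> /eqP e1 /eqP e2; exists x; first by rewrite mem_enum inE lx.
by congr mkpair; rewrite /point; congr (Posz (_ + nat_of_ord _)); exact: esym.
Qed.

(** If the agreement set spans no pair, the events are independent and the term 1 suffices;
    otherwise it is one of the sets [S]. Summing over all [S] makes the later sum over [t']
    tractable. *)
Lemma avg_edges2_le (R : realType) (k M : nat) (p : R) (t t' : transv k M)
    (w0 : epair -> bool) :
  0 < p ->
  avg p (board k M) (fun w => (all w (edges predT t))%:R * (all w (edges predT t'))%:R) w0 <=
  (p ^+ #|up (@predT ('I_k * 'I_k))|) ^+ 2 *
    (1 + \sum_(S : {set 'I_k} | (0 < #|up (inside S)|)%N)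
           agrees R S t t' / p ^+ #|up (inside S)|).
Proof.
move=> p0; have := avg_edges2 p t t' w0.
set A := avg _ _ _ _; set S0 := [set l | _]; set q := p ^+ #|up predT|.
have pge0 n : 0 <= p ^+ n by rewrite exprn_ge0 ?ltW.
have term_ge0 S : 0 <= agrees R S t t' / p ^+ #|up (inside S)|.
  by rewrite mulr_ge0 ?invr_ge0 ?agrees_ge0.
case: (posnP #|up (inside S0)|) => [->|c0] E.
  rewrite -E expr0 mulr1 mulrDr mulr1 lerDl; apply: mulr_ge0.
    by rewrite -[A]mulr1 -(expr0 p) E exprn_ge0 ?pge0.
  by apply: sumr_ge0 => S _; exact: term_ge0.
have agr : agrees R S0 t t' = 1.
  by apply: big1 => l _; rewrite inE eq_sym implybb.
have -> : A = q ^+ 2 / p ^+ #|up (inside S0)|.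
  by rewrite -E mulfK // expf_neq0 // lt0r_neq0.
apply: ler_wpM2l; first exact: exprn_ge0 (pge0 _).
rewrite (bigD1 S0) //= agr div1r addrCA lerDl; apply: addr_ge0 => //.
by apply: sumr_ge0 => S _; exact: term_ge0.
Qed.

(** Second moment of the number of open transversals: relative to the squared mean, each [S]
    contributes at most [1 / c], and there are at most [2 ^ k] of them. *)
Lemma avg_clique (R : realType) (k M : nat) (n : nat -> nat) (p c : R)
    (w0 : epair -> bool) :
  0 < p <= 1 -> 0 < c -> (forall l, 0 < n l <= M.+1)%N ->
  (forall S : {set 'I_k}, (0 < #|up (inside S)|)%N ->
     c <= p ^+ #|up (inside S)| * \prod_(l in S) (n l)%:R) ->
  avg p (board k M) (fun w => (~~ clique k M n w)%:R) w0 <= (2 ^ k)%:R / c.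
Proof.
move=> /andP[p0 p1] c0 nM large.
have n_le l : (n l <= M.+1)%N by case/andP: (nM l).
have n_gt l : 0 < (n l)%:R :> R by rewrite ltr0n; case/andP: (nM l).
have p01 : 0 <= p <= 1 by rewrite p1 ltW.
pose m := #|up (@predT ('I_k * 'I_k))|.
pose N w : R := \sum_(t in @parts k M n) (all w (edges predT t))%:R.
pose P : R := \prod_(l < k) (n l)%:R.
have P0 : 0 < P by apply: prodr_gt0.
have EP : (#|@parts k M n|)%:R = P by rewrite card_parts.
apply: (@avg_second_moment _ _ _ _ N _ (P * p ^+ m)) => //.
- by rewrite mulr_gt0 ?exprn_gt0.
- move=> w; rewrite negb_exists => /forallP no; apply: big1 => t tn.
  by have := no t; rewrite tn /= => /negbTE ->.
- rewrite avg_sum -EP mulr_natl -sumr_const; apply: eq_bigr => t _.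
  rewrite avg_all ?undup_uniq ?uniq_edges ?size_edges //; exact: edges_board.
have -> : (fun w => N w ^+ 2) = fun w => \sum_(t in @parts k M n) \sum_(t' in @parts k M n)
    (all w (edges predT t))%:R * (all w (edges predT t'))%:R.
  by apply: funext => w; rewrite /N expr2 mulr_suml; apply: eq_bigr => t _; rewrite mulr_sumr.
rewrite avg_sum.
have le_t t : t \in @parts k M n -> avg p (board k M) (fun w => \sum_(t' in @parts k M n)
    (all w (edges predT t))%:R * (all w (edges predT t'))%:R) w0 <=
    (p ^+ m) ^+ 2 * (P * (1 + (2 ^ k)%:R / c)).
  move=> tn; rewrite avg_sum.
  apply: le_trans (ler_sum _ (fun t' _ => avg_edges2_le t t' w0 p0)) _.
  rewrite -mulr_sumr ler_wpM2l ?exprn_ge0 ?(ltW p0) // big_split /= sumr_const -mulr_natl mulr1 EP.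
  rewrite mulrDr mulr1 lerD2l exchange_big /=.
  have -> : P * ((2 ^ k)%:R / c) = \sum_(S : {set 'I_k}) P / c.
    by rewrite sumr_const -cardsT -powersetT card_powerset cardsT card_ord -mulr_natl; ring.
  rewrite big_mkcond /=; apply: ler_sum => S _; case: ifP => [cS|_]; last first.
    by rewrite mulr_ge0 ?invr_ge0 ?ltW.
  rewrite -mulr_suml sum_agrees // ler_pdivrMr ?exprn_gt0 //.
  rewrite mulrAC ler_pdivlMr //.
  have -> : P = (\prod_(l in S) (n l)%:R) * \prod_(l < k) (if l \in S then 1 else (n l)%:R).
    rewrite /P (bigID (mem S)) /= [X in _ = _ * X](bigID (mem S)) /=.
    rewrite [X in _ = _ * (X * _)]big1 ?mul1r; last by move=> l ->.
    by congr (_ * _); apply: eq_bigr => l /negbTE ->.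
  rewrite [X in _ <= X]mulrAC mulrC ler_wpM2r ?large //.
    by apply: prodr_ge0 => l _; case: ifP.
  by rewrite mulrC large.
apply: le_trans (ler_sum _ le_t) _; rewrite sumr_const -[leLHS]mulr_natl EP.
by rewrite le_eqVlt; apply/orP; left; apply/eqP; ring.
Qed.

Lemma card_partials (R : realType) (k M : nat) (n : nat -> nat) (i j : 'I_k) :
  (forall l, n l <= M.+1)%N ->
  (#|@partials k M n i j|)%:R =
  \prod_(l < k) (if involved i j l then (n l)%:R else 1) :> R.
Proof.
move=> nM; rewrite -sum1_card natr_sum.
transitivity (\sum_(t in @partials k M n i j) \prod_(l < k) (1 : R)).
  by apply: eq_bigr => t _; rewrite big1.
rewrite -(bigA_distr_big_dep _ (fun _ _ => 1)); apply: eq_bigr => l _.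
rewrite -(sum_ord_lt R (nM l)).
by case: (involved i j l) => //=; rewrite (big_pred1 ord0).
Qed.

(** First moment: a pair is charged to every partial transversal that makes it needed, and there are
    at most [k * k] choices of [(i, j)]. *)
Lemma avg_needed (R : realType) (k M : nat) (n : nat -> nat) (p B : R)
    (w0 : epair -> bool) :
  0 <= p <= 1 -> 0 <= B -> (forall l, n l <= M.+1)%N ->
  (forall i j : 'I_k, (i < j)%N ->
     \prod_(l < k) (if involved i j l then (n l)%:R else 1) *
       p ^+ #|up (before i j)| <= B) ->
  avg p (board k M) (fun w => (size (needed k M n w))%:R) w0 <= (k * k)%:R * B.
Proof.
move=> p01 B0 nM small.
pose Z w : R := \sum_(x : 'I_k * 'I_k | (x.1 < x.2)%N)
  \sum_(t in @partials k M n x.1 x.2) (all w (edges (before x.1 x.2) t))%:R.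
apply: (@le_trans _ _ (avg p (board k M) Z w0)).
  apply: avg_le => // w; apply: (@le_trans _ _ (\sum_(y : ('I_k * 'I_k) * transv k M |
    (y.1.1 < y.1.2)%N && (y.2 \in @partials k M n y.1.1 y.1.2))
      (all w (edges (before y.1.1 y.1.2) y.2))%:R)); last first.
    by rewrite /Z pair_big_dep.
  rewrite -natr_sum ler_nat; apply: leq_trans (size_undup _) _.
  rewrite size_map -cardE -sum1_card big_mkcond [leqRHS]big_mkcond /=.
  apply: leq_sum => y _; rewrite inE; case: (y.1.1 < y.1.2)%N => //=.
  by case: (y.2 \in _) => //=; case: (all _ _).
have -> : (k * k)%:R * B = \sum_(x : 'I_k * 'I_k) B.
  by rewrite sumr_const card_prod card_ord mulr_natl.
rewrite /Z avg_sum.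
rewrite big_mkcond; apply: ler_sum => -[i j] _ /=; case: ifP => // ij.
apply: le_trans (small i j ij); rewrite -(card_partials R i j nM).
rewrite avg_sum mulr_natl -sumr_const; apply: ler_sum => t _.
rewrite avg_all ?undup_uniq ?uniq_edges ?size_edges //; exact: edges_board.
Qed.

(** The constants leave probability at most one quarter to the absence of a clique, and one quarter
    to more than [N] needed queries. *)
Lemma greedy_clique (R : realType) (k N : nat) (n : nat -> nat) (p B : R) :
  0 < p <= 1 -> 0 <= B -> (forall l, 0 < n l)%N ->
  (forall S : {set 'I_k}, (0 < #|up (inside S)|)%N ->
     (4 * 2 ^ k)%:R <= p ^+ #|up (inside S)| * \prod_(l in S) (n l)%:R) ->
  (forall i j : 'I_k, (i < j)%N ->
     \prod_(l < k) (if involved i j l then (n l)%:R else 1) *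
       p ^+ #|up (before i j)| <= B) ->
  4 * (k * k)%:R * B <= N.+1%:R ->
  exists s, 2^-1 <= win_prob (K k) p s N.
Proof.
move=> p01 B0 n0 large small leN; have /andP[p0 p1] := p01.
have p01' : 0 <= p <= 1 by rewrite ltW.
(* Only the first [k] part sizes matter. *)
pose n' l := if (l < k)%N then n l else 1%N.
pose M := \max_(l < k) n l.
have n'E (l : 'I_k) : n' l = n l by rewrite /n' ltn_ord.
have n'M l : (0 < n' l <= M.+1)%N.
  rewrite /n'; case: ifP => // lk; rewrite n0 /= leqW //.
  exact: (leq_bigmax (F := fun l : 'I_k => n l) (Ordinal lk)).
have n'_le l : (n' l <= M.+1)%N by case/andP: (n'M l).
pose s := greedy (needed k M n'); exists s; rewrite win_probE.
pose w0 : epair -> bool := fun=> false.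
have := greedy_wins (H := K k) p01' (undup_uniq _) (@needed_board k M n')
  (fun w => undup_uniq _) (@needed_mono k M n') (@clique_closed k M n')
  (@clique_copy k M n') N w0.
apply: le_trans.
set U := board k M.
have fail : avg p U (fun w => (~~ clique k M n' w)%:R) w0 <= 4^-1.
  have c0 : 0 < (4 * 2 ^ k)%:R :> R by rewrite ltr0n muln_gt0 expn_gt0.
  apply: le_trans (avg_clique w0 p01 c0 n'M _) _ => [S /large|].
    by under eq_bigr do rewrite -n'E.
  by rewrite natrM invfM mulrCA mulfV ?mulr1 // pnatr_eq0 -lt0n expn_gt0.
have slow : avg p U (fun w => (N < size (needed k M n' w))%N%:R) w0 <= 4^-1.
  have := avg_markov U (fun w => size (needed k M n' w)) N w0 p01'.
  have cost : avg p U (fun w => (size (needed k M n' w))%:R) w0 <= (k * k)%:R * B.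
    apply: avg_needed => // i j /small; under eq_bigr do rewrite -n'E; exact.
  move=> /le_trans /(_ cost).
  have N0 : 0 < N.+1%:R :> R by rewrite ltr0n.
  by rewrite -ler_pdivlMl // => /le_trans; apply; rewrite ler_pdivrMl //; lra.
have : avg p U (fun w => 1) w0 <= avg p U (fun w =>
    (clique k M n' w && (size (needed k M n' w) <= N)%N)%:R +
    ((~~ clique k M n' w)%:R + (N < size (needed k M n' w))%N%:R)) w0.
  apply: avg_le => // w; rewrite ltnNge.
  by case: (clique _ _ _ _); case: (_ <= N)%N => /=; rewrite ?addr0 ?add0r ?lerDl.
rewrite !avgD avg_const; lra.
Qed.

(** * Choice of the part sizes *)

Lemma card_up (k : nat) (A : pred ('I_k * 'I_k)) :
  #|up A| = (\sum_(i < k) \sum_(j < k) ((i < j) && A (i, j)))%N.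
Proof.
rewrite -sum1_card big_mkcond pair_bigA; apply: eq_bigr => -[i j] _.
by rewrite inE; case: (_ && _).
Qed.

(* Part [l] gets about [q ^- a l] vertices, where [p = q ^+ r]. *)
Definition balanced (k r A : nat) (a : nat -> nat) : Prop :=
  (forall S : {set 'I_k}, (r * #|up (inside S)| <= \sum_(l in S) a l)%N) /\
  (forall i j : 'I_k, (i < j)%N ->
     (\sum_(l < k | involved i j l) a l <= A + r * #|up (before i j)|)%N).

Lemma clique_strategy (R : realType) (k r A : nat) (a : nat -> nat) :
  balanced k r A a ->
  exists2 C : R, 0 < C & forall q : R, 0 < q < 1 ->
    exists N s, N%:R <= C / q ^+ A /\ 2^-1 <= win_prob (K k) (q ^+ r) s N.
Proof.
move=> [bal_in bal_before].
pose c : R := (4 * 2 ^ k)%:R.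
have c1 : 1 <= c by rewrite ler1n muln_gt0 expn_gt0.
have c0 : 0 < c by apply: lt_le_trans c1.
(* A factor [c + 1] for each part; the parts not involved may receive it too, as it is at least
   1. *)
pose D : R := (c + 1) ^+ k.
have D0 : 0 < D by rewrite exprn_gt0 // addr_gt0.
(* The final [+ 1] keeps the constant positive when [k = 0]. *)
exists (4 * (k * k)%:R * D + 1) => [|q /andP[q0 q1]].
  by rewrite ltr_wpDl // mulr_ge0 ?(ltW D0) // mulr_ge0.
have qX0 m : 0 < q ^+ m by rewrite exprn_gt0.
have qX_le m m' : (m <= m')%N -> q ^+ m' <= q ^+ m by apply: ler_wiXn2l; apply: ltW.
have qX1 m : q ^+ m <= 1 by rewrite -[leRHS](expr0 q) qX_le.
(* Rounding up adds at most 1, which is absorbed in [c + 1] because [q ^+ a l <= 1]. *)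
pose n l := (Num.truncn (c / q ^+ a l)).+1.
have n_ge l : c / q ^+ a l <= (n l)%:R by apply/ltW/truncnS_gt.
have n_le l : (n l)%:R <= (c + 1) / q ^+ a l.
  rewrite /n -natr1 mulrDl lerD //; last by rewrite div1r invf_ge1.
  by rewrite truncn_le mulr_ge0 ?invr_ge0 ?ltW.
pose B : R := D / q ^+ A.
have B0 : 0 <= B by rewrite mulr_ge0 ?invr_ge0 ?ltW.
pose N := Num.truncn (4 * (k * k)%:R * B).
have large (S : {set 'I_k}) : (0 < #|up (inside S)|)%N ->
    c <= (q ^+ r) ^+ #|up (inside S)| * \prod_(l in S) (n l)%:R.
  case/card_gt0P => x; rewrite !inE => /and3P[_ xS _].
  have leX : \prod_(l in S) (c / q ^+ a l) <= \prod_(l in S) (n l)%:R.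
    by apply: ler_prod => l _; rewrite n_ge andbT mulr_ge0 ?invr_ge0 ?ltW.
  apply: le_trans (ler_wpM2l (ltW _) leX); last by rewrite -exprM.
  rewrite big_split /= prodfV -expr_sum -exprM prodr_const.
  rewrite mulrCA -[leLHS]mulr1 ler_pM ?(ltW c0) //.
    (* [S] is nonempty and [c >= 1], hence [c] is at most its power [#|S|]. *)
    by rewrite -[leLHS]expr1 ler_weXn2l //; apply/card_gt0P; exists x.1.
  by rewrite ler_pdivlMr // mul1r qX_le.
have small (i j : 'I_k) : (i < j)%N ->
    \prod_(l < k) (if involved i j l then (n l)%:R else 1) *
      (q ^+ r) ^+ #|up (before i j)| <= B.
  move=> ij; apply: (@le_trans _ _ ((D / \prod_(l < k | involved i j l) q ^+ a l) *
      (q ^+ r) ^+ #|up (before i j)|)).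
    apply: ler_wpM2r; first by rewrite exprn_ge0 // ltW.
    have -> : D = \prod_(l < k) (c + 1) by rewrite prodr_const card_ord.
    rewrite -prodfV [X in _ * X]big_mkcond -big_split /=.
    apply: ler_prod => l _; case: ifP => _; first by rewrite ler0n n_le.
    by rewrite mulr1 ler01 lerDr ltW.
  rewrite -expr_sum -exprM /B mulrAC ler_pdivrMr // mulrAC ler_pdivlMr //.
  rewrite -!mulrA ler_wpM2l ?(ltW D0) // -exprD addnC qX_le //; exact: bal_before.
have leN : 4 * (k * k)%:R * B <= N.+1%:R by apply/ltW/truncnS_gt.
have p01 : 0 < q ^+ r <= 1 by rewrite qX0 qX1.
have n0 l : (0 < n l)%N by [].
have [s win] := greedy_clique p01 B0 n0 large small leN.
exists N, s; split=> //.
apply: (@le_trans _ _ (4 * (k * k)%:R * B)).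
  by rewrite truncn_le mulr_ge0 // mulr_ge0.
by rewrite /B mulrA ler_wpM2r ?invr_ge0 ?(ltW (qX0 _)) // lerDl.
Qed.

Lemma f_le (R : realType) (k r A : nat) (a : nat -> nat) :
  balanced k r A a -> (0 < r)%N ->
  exists2 C : R, 0 < C & forall p : R, 0 < p < 1 ->
    (f (K k) p <= (C * p `^ (- (A%:R / r%:R)))%:E)%E.
Proof.
move=> bal r0; have [C C0 strat] := clique_strategy R bal; exists C => // p /andP[p0 p1].
(* With this root of [p], all the exponents become natural numbers. *)
pose q := p `^ r%:R^-1.
have q0 : 0 < q by apply: powR_gt0.
have qr : q ^+ r = p by rewrite /q -[r%:R^-1]mul1r (powR_root 1).
have q1 : q < 1.
  rewrite ltNge; apply/negP => q1; have : 1 <= q ^+ r by apply: exprn_ege1.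
  by rewrite qr leNgt p1.
have [|N [s [leN win]]] := strat q; first by rewrite q0.
rewrite powRN mulrC (_ : p `^ _ = q ^+ A); last first.
  by rewrite -powR_mulrn ?ltW // -powRrM mulrC.
apply: (@le_trans _ _ (N%:R)%:E); last by rewrite lee_fin mulrC.
by apply: ereal_inf_lbound; exists N => //; exists s; rewrite -qr.
Qed.

(** The whole vertex set is tight, [2 * 3 = 3 + 3], and so are the queries from part 0. *)
Lemma balanced_K3 : balanced 3 2 3 (nth 0%N [:: 0; 3; 3]%N).
Proof.
split=> [S|i j]; rewrite card_up.
  rewrite [leqRHS]big_mkcond !big_ord_recl !big_ord0 /= /inside /=.
  move: (ord0 \in S) (lift ord0 ord0 \in S) (lift ord0 (lift ord0 ord0) \in S).
  by do 3!case.
rewrite /before /involved big_mkcond !big_ord_recl !big_ord0 -!val_eqE /=.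
by case: i j => [[|[|[|//]]] ?] [[|[|[|//]]] ?].
Qed.

Lemma balanced_K4 : balanced 4 1 2 (nth 0%N [:: 0; 2; 2; 2]%N).
Proof.
split=> [S|i j]; rewrite card_up.
  rewrite [leqRHS]big_mkcond !big_ord_recl !big_ord0 /= /inside /=.
  move: (ord0 \in S) (lift ord0 ord0 \in S) (lift ord0 (lift ord0 ord0) \in S)
    (lift ord0 (lift ord0 (lift ord0 ord0)) \in S).
  by do 4!case.
rewrite /before /involved big_mkcond !big_ord_recl !big_ord0 -!val_eqE /=.
by case: i j => [[|[|[|[|//]]]] ?] [[|[|[|[|//]]]] ?].
Qed.

(** The whole vertex set is tight, [3 * 10 = 6 + 8 + 8 + 8], and so are the queries from part 1,
    [6 + 8 = 8 + 3 * 2]. With 8 in place of 6, the latter would cost too much. *)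
Lemma balanced_K5 : balanced 5 3 8 (nth 0%N [:: 0; 6; 8; 8; 8]%N).
Proof.
split=> [S|i j]; rewrite card_up.
  rewrite [leqRHS]big_mkcond !big_ord_recl !big_ord0 /= /inside /=.
  move: (ord0 \in S) (lift ord0 ord0 \in S) (lift ord0 (lift ord0 ord0) \in S)
    (lift ord0 (lift ord0 (lift ord0 ord0)) \in S)
    (lift ord0 (lift ord0 (lift ord0 (lift ord0 ord0))) \in S).
  by do 5!case.
rewrite /before /involved big_mkcond !big_ord_recl !big_ord0 -!val_eqE /=.
by case: i j => [[|[|[|[|[|//]]]]] ?] [[|[|[|[|[|//]]]]] ?].
Qed.

Lemma theta_clique (R : realType) (m k F J r A : nat) (a : nat -> nat) (b : R) :
  check m k F J -> (0 < F)%N -> balanced k r A a -> (0 < r)%N ->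
  (F + J)%:R / F%:R = b -> A%:R / r%:R = b ->
  theta01 (fun p : R => f (K k) p) (fun p : R => p `^ (- b)).
Proof.
move=> ck F0 bal r0 Eb Eb'.
have [c c0 lb] := f_ge R ck F0; have [C C0 ub] := f_le R bal r0.
by exists c, C; split=> //; split=> // p p01; rewrite -{1}Eb -Eb' lb // ub.
Qed.

Theorem theorem13 (R : realType) :
  theta01 (fun p : R => f (K 3) p) (fun p : R => p `^ (- (3 / 2))) /\
  theta01 (fun p : R => f (K 4) p) (fun p : R => p `^ (- 2)) /\
  theta01 (fun p : R => f (K 5) p) (fun p : R => p `^ (- (8 / 3))).
Proof.
split; last split.
- by apply: (theta_clique check_K3 _ balanced_K3).
- by apply: (theta_clique check_K4 _ balanced_K4) => //; field.
- by apply: (theta_clique check_K5 _ balanced_K5).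
Qed.
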